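(* Let $0<\alpha,\beta<1$ and consider the variable coefficient nonlinear space-time fractional Burgers' equation $$u_t^{(\alpha)} = f(t)\,u_x^{(2\beta)} + g(t)\,\bigl(u_x^{(\beta)}\bigr)^2,\qquad x\in(0,\infty),\ t>0,$$ where $g(t)=k f(t)$ with $k$ a nonzero constant. Let $F(t)$ be a function with $F_t^{(2\alpha)}=f(t)$. The similarity transformation $u(x,t)=\psi(X)$ along with the similarity variable $$X(x,t)=\frac{x^{2\beta}}{\bigl(\Gamma(1+\beta)\bigr)^2F_t^{(\alpha)}}$$ reduces the fractional Burgers' equation to the nonlinear ordinary differential equation $$\psi''(X)+\frac{g(t)}{f(t)}\bigl(\psi'(X)\bigr)^2+\frac14\psi'(X)+\frac{1}{2X}\psi'(X)=0,$$ which leads to the solution $$u(x,t)=\frac1k\log\left\{k_2+2\pi K\,\mathrm{erf}\!\left(\frac{x^\beta}{2\sqrt{F_t^{(\alpha)}}\;\Gamma(1+\beta)}\right)\right\}+k_3,$$ where $K$, $k_2$ and $k_3$ are arbitrary constants.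
   Context: Fractional derivatives are Jumarie's modified Riemann-Liouville derivatives: for $0<\alpha<1$, $$D_x^\alpha h(x)=\frac{1}{\Gamma(1-\alpha)}\frac{d}{dx}\int_0^x (x-s)^{-\alpha}\bigl(h(s)-h(0)\bigr)\,ds.$$ Notation: $u_t^{(\alpha)}=D_t^\alpha u$, $u_x^{(\beta)}=D_x^\beta u$, $u_x^{(2\beta)}=D_x^\beta D_x^\beta u$; similarly $F_t^{(\alpha)}=D_t^\alpha F$ and $F_t^{(2\alpha)}=D_t^\alpha D_t^\alpha F$. The coefficients $f,g$ are given functions of $t$. A prime denotes the ordinary derivative with respect to the argument $X$, and $\mathrm{erf}$ is the error function. The paper adopts the following calculus rules for this derivative and uses them throughout: the product rule $D_x^\alpha(uv)=(D_x^\alpha u)v+u(D_x^\alpha v)$; the chain rule $D_t^\alpha h(x(t))=\frac{dh}{dx}\,D_t^\alpha x(t)$ for $0<\alpha<1$ provided $\frac{dh}{dx}$ exists; and the power rule $D_x^\alpha x^\beta=\frac{\Gamma(1+\beta)}{\Gamma(1+\beta-\alpha)}x^{\beta-\alpha}$. ''Reduces to'' means that substituting the given form of $u$ into the Burgers' equation, using these rules, yields the stated equation for the function of the similarity variable.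
   Formalization: The adopted rules contradict each other for Jumarie's derivative (D^β x^{2β} gets two values), so the derivatives in Burgers' equation are any operators on (0,∞) obeying the product and chain rules that agree with Jumarie's derivative on F_t^(α) in t and x^β in x. *)

(* Defs.v *)
From HB Require Import structures.
From mathcomp Require Import all_boot all_order all_algebra.
From mathcomp Require Import all_classical all_reals all_analysis.
Set Implicit Arguments.
Unset Strict Implicit.
Unset Printing Implicit Defensive.
Import Order.TTheory GRing.Theory Num.Theory.
Import numFieldNormedType.Exports.
Local Open Scope ring_scope.
Local Open Scope classical_set_scope.

(* Meaningful for z > 0, the only arguments used. *)
Definition Gamma (R : realType) (z : R) : R :=
  \int[lebesgue_measure]_(s in `]0, +oo[) (s `^ (z - 1) * expR (- s)).

(* One of the two integrals is over a null set, according to the sign of z. *)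
Definition erf (R : realType) (z : R) : R :=
  2 / Num.sqrt pi *
  (\int[lebesgue_measure]_(s in `[0, z]) expR (- s ^+ 2)
   - \int[lebesgue_measure]_(s in `[z, 0]) expR (- s ^+ 2)).

Definition jumarie_kernel (R : realType) (gamma : R) (h : R -> R) (y s : R) : R :=
  (y - s) `^ (- gamma) * (h s - h 0).

Definition jumarie_primitive (R : realType) (gamma : R) (h : R -> R) (y : R) : R :=
  \int[lebesgue_measure]_(s in `[0, y]) jumarie_kernel gamma h y s.

(* The modified Riemann-Liouville derivative of order gamma of h at x exists
   and equals l. *)
Definition is_jumarie (R : realType) (gamma : R) (h : R -> R) (x l : R) : Prop :=
  [/\ \forall y \near x, (@lebesgue_measure R).-integrable `[0, y]
        (EFin \o jumarie_kernel gamma h y),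
      derivable (jumarie_primitive gamma h) x 1 &
      l = (Gamma (1 - gamma))^-1 * derive1 (jumarie_primitive gamma h) x].

Definition jumarie_power_rule (R : realType) : Prop :=
  forall gamma delta x : R, 0 < gamma < 1 -> 0 < delta -> 0 < x ->
    is_jumarie gamma (fun s => s `^ delta) x
      (Gamma (1 + delta) / Gamma (1 + delta - gamma) * x `^ (delta - gamma)).

(* The fractional derivative of order gamma on (0, +oo), as computed with the
   adopted rules: [D h x l] reads "D^gamma h exists at x and equals l".
   The product and chain rules cannot be assumed of [is_jumarie] itself, nor of
   any D agreeing with it everywhere: they give
     D^gamma (x^gamma)^2 = 2 Gamma(1+gamma) x^gamma,
   while the power rule gives
     D^gamma x^(2 gamma) = Gamma(1+2 gamma) / Gamma(1+gamma) x^gamma,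
   and these differ for 0 < gamma < 1.  So D has to agree with [is_jumarie] on
   one function xi only, from which the rules compute everything else. *)
Record jumarie_calculus (R : realType) (gamma : R) (xi : R -> R)
    (D : (R -> R) -> R -> R -> Prop) : Prop := JumarieCalculus {
  jc_base : forall x l : R, 0 < x -> is_jumarie gamma xi x l -> D xi x l ;
  jc_unique : forall (h : R -> R) (x l1 l2 : R), 0 < x -> D h x l1 -> D h x l2 -> l1 = l2 ;
  jc_ext : forall (h1 h2 : R -> R) (x l : R), 0 < x ->
    (forall y : R, 0 < y -> h1 y = h2 y) -> D h1 x l -> D h2 x l ;
  jc_product : forall (u v : R -> R) (x a b : R), 0 < x -> D u x a -> D v x b ->
    D (fun y => u y * v y) x (a * v x + u x * b) ;
  jc_chain : forall (h y : R -> R) (x a : R), 0 < x -> D y x a ->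
    derivable h (y x) 1 -> D (h \o y) x (derive1 h (y x) * a)
}.

(* Such a D exists as soon as xi is regular: D^gamma h = h' / xi' D^gamma xi. *)
Lemma jumarie_calculus_exists (R : realType) (gamma : R) (xi : R -> R) :
  (forall x : R, 0 < x -> derivable xi x 1 /\ derive1 xi x != 0) ->
  exists D, jumarie_calculus gamma xi D.
Proof.
move=> hxi.
pose J x := (Gamma (1 - gamma))^-1 * derive1 (jumarie_primitive gamma xi) x.
exists (fun (h : R -> R) (x l : R) => derivable h x 1 /\ l = derive1 h x * (J x / derive1 xi x)).
split.
- move=> x l x0 [_ _ ->]; have [dx nx] := hxi x x0; split=> //.
  by rewrite mulrCA divff // mulr1.
- by move=> h x l1 l2 _ [_ ->] [_ ->].
- move=> h1 h2 x l x0 eh [d1 ->].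
  have E : \forall y \near x, h1 y = h2 y.
    near=> y; apply: eh; near: y; exact: lt_nbhsr.
  split; first by apply: near_eq_derivable d1.
  by rewrite !derive1E (near_eq_derive (1 : R) E).
- move=> u v x a b _ [du ->] [dv ->]; split; first exact: derivableM.
  rewrite !derive1E (_ : (fun y => _) = u * v)// deriveM//.
  rewrite mulrDl addrC; congr (_ + _); first exact: mulrA.
  by rewrite mulrAC [v x *: _]mulrC.
- move=> h y x a _ [dy ->] dh; split.
    by apply/derivable1_diffP; apply: differentiable_comp;
      apply/derivable1_diffP.
  by rewrite (derive1_comp dy dh); exact: mulrA.
Unshelve. all: by end_near. Qed.

(* u_t^(alpha) = f u_x^(2 beta) + g (u_x^(beta))^2 at (x, t), where Dt and Dx
   are the derivatives of orders alpha in t and beta in x, and b is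
   u_x^(beta)(., t) on (0, +oo). *)
Definition burgers_at (R : realType) (Dt Dx : (R -> R) -> R -> R -> Prop)
    (f g : R -> R) (u : R -> R -> R) (x t : R) : Prop :=
  exists (a : R) (b : R -> R) (c : R),
    [/\ Dt (fun s => u x s) t a,
        (forall y : R, 0 < y -> Dx (fun z => u z t) y (b y)),
        Dx b x c &
        a = f t * c + g t * b x ^+ 2].

Definition similarity_var (R : realType) (beta : R) (G : R -> R) (x t : R) : R :=
  x `^ (2 * beta) / (Gamma (1 + beta) ^+ 2 * G t).

Definition similarity_ode (R : realType) (c : R) (psi : R -> R) (X : R) : Prop :=
  derive1n 2 psi X + c * (derive1 psi X) ^+ 2 + 1 / 4 * derive1 psi X
    + 1 / (2 * X) * derive1 psi X = 0.

Definition log_argument (R : realType) (beta : R) (G : R -> R) (K k2 : R)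
    (x t : R) : R :=
  k2 + 2 * pi * K * erf (x `^ beta / (2 * Num.sqrt (G t) * Gamma (1 + beta))).

Definition burgers_solution (R : realType) (beta k : R) (G : R -> R)
    (K k2 k3 : R) (x t : R) : R :=
  1 / k * ln (log_argument beta G K k2 x t) + k3.

(* Main.v *)
Require Import Defs.
From HB Require Import structures.
From mathcomp Require Import all_boot all_order all_algebra.
From mathcomp Require Import all_classical all_reals all_analysis.
From mathcomp Require Import measurable_realfun ring lra.
Import Order.TTheory GRing.Theory Num.Theory.
Import numFieldNormedType.Exports.
Local Open Scope ring_scope.
Local Open Scope classical_set_scope.

(** On functions of [x `^ beta] the derivative of order [beta] is an ordinary
    one in disguise.  Put [w = x `^ beta] and [c = Gamma (1 + beta)].  The power
    rule gives [D^beta w = c], because [Gamma 1 = 1], so by the chain rule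
    [D^beta h(w) = c h'(w)]; likewise the derivative of order [alpha] of [h(G)]
    is [h'(G) f].  The similarity variable is [X = w ^ 2 / (c ^ 2 G)], hence for
    [u = psi(X)] the fractional derivatives are
    - [u_t = - psi'(X) X f / G],
    - [u_x = 2 w psi'(X) / (c G)], so that [(u_x) ^ 2 = 4 X psi'(X) ^ 2 / G],
    - [u_xx = (4 X psi''(X) + 2 psi'(X)) / G].
    The Burgers equation is then the similarity equation multiplied by
    [4 X f / G], which does not vanish; this is [similarity_reduction].

    The similarity equation with [g / f = k] is linearized by [L = exp (k psi)]:
    it becomes [L'' = - (1 / 4 + 1 / (2 X)) L'].  With the integrating factor
    [T = exp (X / 4) sqrt X] this says that [L' T] is constant, and [1 / T] is,
    up to a constant, the derivative of [erf (sqrt X / 2)].  Therefore the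
    solutions are exactly the [L = k2 + 2 pi K erf (sqrt X / 2)], which is
    [log_erf_profile_ode] in one direction and [similarity_ode_profile] in the
    other.  When [G] is positive, [sqrt X / 2] is the argument of [erf] in the
    formula, and for a single [t] the variable [X] already runs through all
    positive numbers, so that solving along the similarity variable and solving
    on the half-line are the same thing.

    Dividing by [c] requires [Gamma (1 + beta) != 0], which rests on the
    convergence of the defining integral. *)

(** * The Gamma function at 1 and between 1 and 2 *)

Lemma integrable_expR_decay {R : realType} {r : R} : 0 < r ->
  (@lebesgue_measure R).-integrable `]0, +oo[ (fun s => (expR (- r * s))%:E).
Proof.
move=> r0.
have I : (@lebesgue_measure R).-integrable `]0, +oo[
    (EFin \o exponential_pdf r).
  apply: (@integrableS _ _ _ _ setT) => //.
  exact: integrable_exponential_pdf.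
apply: (eq_integrable _ _ _ _ (integrableZl _ r^-1 I)) => // s.
rewrite inE/= in_itv/= andbT => s0.
by rewrite exponential_pdfE ?ltW// -EFinM mulKf// gt_eqF.
Qed.

Lemma Rintegral_expR_decay {R : realType} {r : R} : 0 < r ->
  \int[lebesgue_measure]_(s in `]0, +oo[) expR (- r * s) = r^-1.
Proof.
move=> r0.
have r_neq0 : r != 0 by rewrite gt_eqF.
apply: (mulfI r_neq0); rewrite divff ?gt_eqF//.
rewrite -RintegralZl//; last exact: integrable_expR_decay.
rewrite Rintegral_itv_obnd_cbnd; last first.
  exact: (integrableZl _ r (integrable_expR_decay r0)).
rewrite Rintegral_mkcond /Rintegral.
by have /= := integral_exponential_pdf r0; rewrite /exponential_pdf => ->.
Qed.

Lemma Gamma1 (R : realType) : Gamma (1 : R) = 1.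
Proof.
rewrite /Gamma -[RHS]invr1 -(Rintegral_expR_decay (@ltr01 R)).
by apply: eq_Rintegral => s _; rewrite subrr powRr0 mul1r mulN1r.
Qed.

(** The integrand lies between two combinations of decaying exponentials,
    [exp (-s) - exp (-2s)] and [2 exp (-s / 2)], because
    [1 - exp (-s) <= s `^ b <= 2 exp (s / 2)] for [0 < b < 1].  The upper bound
    gives integrability, without which the real-valued integral would be the
    junk value 0; the lower bound gives [Gamma (1 + b) >= 1 / 2]. *)
Lemma Gamma_gt0 {R : realType} {b : R} : 0 < b < 1 -> 0 < Gamma (1 + b).
Proof.
move=> /andP[b0 b1].
have half0 : (0 : R) < 2^-1 by rewrite invr_gt0.
have up (s : R) : 0 < s -> s `^ b <= 2 * expR (2^-1 * s).
  move=> s0; have E := expR_ge1Dx (2^-1 * s).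
  have [s1|s1] := lerP s 1.
    have : s `^ b <= 1.
      by rewrite -(powRr0 s); apply: ger_powR; [rewrite s0 s1|exact: ltW].
    lra.
  have : s `^ b <= s by apply: ler1_powR; exact: ltW.
  lra.
have lo (s : R) : 0 < s -> 1 - expR (- s) <= s `^ b.
  move=> s0; have E := expR_ge1Dx (- s); have E0 := expR_gt0 (- s).
  have [s1|s1] := lerP s 1.
    have : s <= s `^ b by apply: ger1_powR; [rewrite s0 s1|exact: ltW].
    lra.
  have : 1 <= s `^ b.
    by rewrite -(powRr0 s); apply: ler_powR; exact: ltW.
  lra.
have I1 := integrable_expR_decay (@ltr01 R).
have I2 := integrable_expR_decay (@ltr0Sn R 1).
have Ih := integrable_expR_decay half0.
have Ig : (@lebesgue_measure R).-integrable `]0, +oo[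
    (EFin \o (fun s => s `^ (1 + b - 1) * expR (- s))).
  apply: (le_integrable _ _ _ (integrableZl _ 2 Ih)) => //.
    apply/measurable_EFinP; apply: measurable_funTS.
    by apply: measurable_funM => //; apply: measurableT_comp.
  move=> s /=; rewrite in_itv/= andbT => s0.
  rewrite lee_fin !ger0_norm ?mulr_ge0 ?powR_ge0 ?expR_ge0//.
  rewrite addrAC subrr add0r.
  apply: le_trans (ler_wpM2r (expR_ge0 _) (up s s0)) _.
  rewrite -mulrA -expRD; have -> // : 2^-1 * s - s = - 2^-1 * s by lra.
have le : 1^-1 - 2^-1 <= Gamma (1 + b).
  rewrite -(Rintegral_expR_decay (@ltr01 R)).
  rewrite -(Rintegral_expR_decay (@ltr0Sn R 1)) -RintegralB// /Gamma.
  apply: le_Rintegral => //; first exact: (integrableB _ I1 I2).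
  move=> s /=; rewrite in_itv/= andbT => s0.
  rewrite [1 + b - 1]addrAC subrr add0r.
  have -> : - 2%:R * s = - s + - s by lra.
  rewrite mulN1r expRD -[X in X - _]mul1r -mulrBl.
  by apply: ler_wpM2r; [exact: expR_ge0|exact: lo].
by apply: lt_le_trans le; lra.
Qed.

(** * The error function and constancy on the half-line *)

Lemma is_derive_erf {R : realType} {z : R} : 0 < z ->
  is_derive z 1 (@erf R) (2 / Num.sqrt pi * expR (- z ^+ 2)).
Proof.
move=> z0.
pose I y := \int[@lebesgue_measure R]_(s in `[0, y]) gauss_fun s.
have [dI I'] : derivable I z 1 /\ derive1 I z = gauss_fun z.
  apply: (@continuous_FTC1 R gauss_fun (BLeft 0) _ (z + 1) _ _ _ _).
  - by rewrite ltrDl.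
  - apply: continuous_compact_integrable => //; first exact: segment_compact.
    by apply: continuous_subspaceT; exact: continuous_gauss_fun.
  - by rewrite /=; rewrite lte_fin.
  - by move=> ?; exact: continuous_gauss_fun.
apply: (@near_eq_is_derive _ _ _ ((2 / Num.sqrt pi) \*: I)).
  (* near a positive point the second integral of erf is over the empty set *)
  near=> y.
  have y0 : 0 < y by near: y; exact: lt_nbhsr.
  rewrite /erf (_ : `[y, 0]%classic = set0) ?Rintegral_set0 ?subr0//.
  by apply/seteqP; split=> // s /=; rewrite in_itv/= => /andP[? ?]; lra.
rewrite -[expR _]/(gauss_fun z) -I' derive1E.
by apply: is_deriveZ; exact/derivableP.
Unshelve. all: by end_near. Qed.

(** Composing with [expR] transports the half-line to the whole line. *)
Lemma derive0_gt0_cst {R : realType} {h : R -> R} {x y : R} :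
  (forall z : R, 0 < z -> is_derive z 1 h 0) -> 0 < x -> 0 < y -> h x = h y.
Proof.
move=> dh x0 y0.
rewrite -(lnK (x0 : x \in Num.pos)) -(lnK (y0 : y \in Num.pos)).
apply: (@is_derive_0_is_cst _ (h \o expR)) => z.
by have := is_derive1_comp (dh _ (expR_gt0 z)) (is_derive_expR z);
  rewrite mul0r.
Qed.

(** * Reduction of the Burgers equation *)

Lemma is_derive_derive1 {R : realType} {h : R -> R} {x d : R} :
  is_derive x 1 h d -> derive1 h x = d.
Proof. by move=> dh; rewrite derive1E; exact: derive_val. Qed.

Lemma derivable_is_derive1 {R : realType} {h : R -> R} {x : R} :
  derivable h x 1 -> is_derive x 1 h (derive1 h x).
Proof. by rewrite derive1E => /derivableP. Qed.

Lemma is_derive_scaled_sqr {R : realType} (m w : R) :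
  is_derive w 1 (fun v : R => m * v ^+ 2) (m * (2 * w)).
Proof.
have dw := is_derive_id w (1 : R).
have := is_deriveZ m (is_deriveM dw dw).
rewrite (_ : m \*: _ = fun v : R => m * v ^+ 2); last first.
  by apply/funext => v; rewrite expr2.
by move/is_derive_eq; apply; rewrite /GRing.scale/=; ring.
Qed.

Lemma jc_chain_is_derive {R : realType} {gamma : R} {xi : R -> R}
    {D : (R -> R) -> R -> R -> Prop} (hD : jumarie_calculus gamma xi D)
    {h y : R -> R} {x a d : R} :
  0 < x -> D y x a -> is_derive (y x) 1 h d -> D (h \o y) x (d * a).
Proof.
move=> x0 Dy dh; rewrite -(is_derive_derive1 dh).
by apply: (jc_chain hD).
Qed.

(** The power rule with exponent equal to the order: the result is constant,
    which is what makes [x `^ beta] play the part of the ordinary variable. *)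
Lemma jumarie_powR_self {R : realType} {beta : R}
    {D : (R -> R) -> R -> R -> Prop} (hbeta : 0 < beta < 1)
    (hpow : jumarie_power_rule R)
    (hD : jumarie_calculus beta (fun x => x `^ beta) D) (x : R) :
  0 < x -> D (fun y => y `^ beta) x (Gamma (1 + beta)).
Proof.
move=> x0; apply: (jc_base hD) => //.
have b0 : 0 < beta by case/andP: hbeta.
have := hpow beta beta x hbeta b0 x0.
by rewrite addrK Gamma1 divr1 subrr powRr0 mulr1.
Qed.

Lemma burgers_at_ext {R : realType} {alpha beta : R} {xit xix : R -> R}
    {Dt Dx : (R -> R) -> R -> R -> Prop} {f g : R -> R}
    (hDt : jumarie_calculus alpha xit Dt) (hDx : jumarie_calculus beta xix Dx)
    {u v : R -> R -> R} {x t : R} :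
  0 < x -> 0 < t -> (forall y s, 0 < y -> 0 < s -> u y s = v y s) ->
  burgers_at Dt Dx f g u x t -> burgers_at Dt Dx f g v x t.
Proof.
move=> x0 t0 uv [a [b [c [Da Db Dc e]]]]; exists a, b, c; split=> //.
- by apply: (jc_ext hDt) Da => // s s0; exact: uv.
- move=> y y0; apply: (jc_ext hDx) (Db y y0) => // z z0; exact: uv.
Qed.

Lemma powR_double {R : realType} (x beta : R) : x `^ (2 * beta) = (x `^ beta) ^+ 2.
Proof. by rewrite mulrC powRrM -[2]/(2%:R) powR_mulrn ?powR_ge0. Qed.

(** All derivatives are computed by the chain rule alone, with [x `^ beta] and
    [G] as inner functions: in [x] the outer function is [psi (m w ^ 2)] with
    [m = 1 / (c ^ 2 G t)], in [t] it is [psi (A / r)] with [A = x `^ (2 beta) / c ^ 2].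
    Uniqueness of the derivatives turns this computation into an equivalence. *)
Lemma similarity_reduction {R : realType} {alpha beta : R} {f g G : R -> R}
    {Dt Dx : (R -> R) -> R -> R -> Prop} (hbeta : 0 < beta < 1)
    (hpow : jumarie_power_rule R)
    (hDt : jumarie_calculus alpha G Dt)
    (hDx : jumarie_calculus beta (fun x => x `^ beta) Dx)
    {psi : R -> R} {x t : R} :
  is_jumarie alpha G t (f t) -> f t != 0 -> G t != 0 -> 0 < x -> 0 < t ->
  (forall y, 0 < y -> derivable psi (similarity_var beta G y t) 1) ->
  derivable (derive1 psi) (similarity_var beta G x t) 1 ->
  burgers_at Dt Dx f g (fun y s => psi (similarity_var beta G y s)) x t <->
  similarity_ode (g t / f t) psi (similarity_var beta G x t).
Proof.
move=> hG ft0 Gt0 x0 t0 dpsi ddpsi.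
set c := Gamma (1 + beta); have c0 : c != 0 by rewrite gt_eqF ?Gamma_gt0.
pose m := (c ^+ 2 * G t)^-1.
have XE (y : R) : similarity_var beta G y t = m * (y `^ beta) ^+ 2.
  by rewrite /similarity_var powR_double mulrC.
set X := similarity_var beta G x t; set w := x `^ beta.
have w0 : w != 0 by rewrite gt_eqF ?powR_gt0.
have Xw : X = m * w ^+ 2 by exact: XE.
pose b y := derive1 psi (m * (y `^ beta) ^+ 2) * (m * (2 * y `^ beta)) * c.
have Db (y : R) : 0 < y -> Dx (fun z => psi (similarity_var beta G z t)) y (b y).
  move=> y0.
  have d1 : is_derive (m * (y `^ beta) ^+ 2) 1 psi
      (derive1 psi (m * (y `^ beta) ^+ 2)).
    by rewrite -XE; exact: derivable_is_derive1 (dpsi y y0).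
  have := jc_chain_is_derive hDx y0 (jumarie_powR_self hbeta hpow hDx y y0)
    (@is_derive1_comp _ psi (fun v => m * v ^+ 2) _ _ _
       d1 (is_derive_scaled_sqr m (y `^ beta))).
  by apply: (jc_ext hDx) => // z z0 /=; rewrite XE.
pose c2 := (derive1 psi X * (m * 2)
            + derive1n 2 psi X * (m * (2 * w)) * (m * (2 * w))) * c * c.
have Dc : Dx b x c2.
  pose h1 v := derive1 psi (m * v ^+ 2) * (m * (2 * v)) * c.
  suff dh1 : is_derive w 1 h1 ((derive1 psi X * (m * 2)
      + derive1n 2 psi X * (m * (2 * w)) * (m * (2 * w))) * c).
    exact: (jc_chain_is_derive hDx x0 (jumarie_powR_self hbeta hpow hDx x x0) dh1).
  have d1 : is_derive w 1 (derive1 psi \o (fun v => m * v ^+ 2))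
      (derive1n 2 psi X * (m * (2 * w))).
    apply: is_derive1_comp (is_derive_scaled_sqr m w).
    by rewrite -Xw; exact: derivable_is_derive1.
  have d2 := is_deriveZ (m * 2) (is_derive_id w (1 : R)).
  have := is_deriveZ c (is_deriveM d1 d2).
  rewrite (_ : c \*: _ = h1); last first.
    apply/funext => v.
    transitivity (c * (derive1 psi (m * v ^+ 2) * (m * 2 * v))) => //.
    by rewrite /h1; ring.
  move/is_derive_eq; apply; rewrite /= -Xw /GRing.scale/=; ring.
pose a := derive1 psi X * (- (X / G t)) * f t.
have Da : Dt (fun s => psi (similarity_var beta G x s)) t a.
  pose A := x `^ (2 * beta) / c ^+ 2.
  have XA s : similarity_var beta G x s = A * (G s)^-1.
    by rewrite /similarity_var -/c invfM mulrA.
  have d1 : is_derive (G t) 1 (fun r => A * r^-1) (- (X / G t)).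
    have := is_deriveZ A (is_deriveV Gt0 (is_derive_id (G t) 1)).
    move/is_derive_eq; apply; rewrite /X XA /GRing.scale/= .
    by field.
  have d2 : is_derive (A * (G t)^-1) 1 psi (derive1 psi X).
    by rewrite -XA; exact: derivable_is_derive1 (dpsi x x0).
  have := jc_chain_is_derive hDt t0 (jc_base hDt t0 hG)
    (@is_derive1_comp _ psi (fun r => A * r^-1) _ _ _ d2 d1).
  by apply: (jc_ext hDt) => // s s0 /=; rewrite XA.
have X0 : X != 0.
  rewrite Xw; apply: mulf_neq0; last exact: expf_neq0.
  by rewrite invr_eq0; apply: mulf_neq0 => //; exact: expf_neq0.
have key : f t * c2 + g t * b x ^+ 2 - a
    = 4 * X * f t / G t * (derive1n 2 psi X + g t / f t * derive1 psi X ^+ 2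
        + 1 / 4 * derive1 psi X + 1 / (2 * X) * derive1 psi X).
  rewrite /c2 /a /b -/w -Xw; move: X0; rewrite Xw /m => X0.
  by field; rewrite ft0 Gt0 c0 w0.
have factor0 : 4 * X * f t / G t != 0.
  by rewrite mulf_neq0 ?invr_eq0// mulf_neq0// mulf_neq0 ?pnatr_eq0.
(* any witnesses of the equation coincide with the computed derivatives *)
split=> [[a' [b' [c' [Da' Db' Dc' e]]]]|ode].
  have ea : a' = a by exact: (jc_unique hDt) Da' Da.
  have eb (y : R) : 0 < y -> b' y = b y.
    by move=> y0; exact: (jc_unique hDx) (Db' y y0) (Db y y0).
  have ec : c' = c2 by apply: (jc_unique hDx) Dc => //; exact: (jc_ext hDx) Dc'.
  apply: (mulfI factor0); rewrite mulr0 -key -ea e ec eb//.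
  exact: subrr.
exists a, b, c2; split=> //; apply/esym/eqP; rewrite -subr_eq0 key.
by rewrite ode mulr0.
Qed.

(** * Solution of the similarity equation *)

Definition integrating_factor {R : realType} (X : R) : R :=
  expR (X / 4) * Num.sqrt X.

Definition erf_profile {R : realType} (K k2 X : R) : R :=
  k2 + 2 * pi * K * erf (Num.sqrt X / 2).

Lemma integrating_factor_neq0 {R : realType} (X : R) :
  0 < X -> integrating_factor X != 0.
Proof. by move=> X0; rewrite gt_eqF// mulr_gt0 ?expR_gt0 ?sqrtr_gt0. Qed.

Lemma is_derive_integrating_factor {R : realType} (X : R) : 0 < X ->
  is_derive X 1 (@integrating_factor R)
    ((1 / 4 + 1 / (2 * X)) * integrating_factor X).
Proof.
move=> X0.
have d1 : is_derive X 1 (fun Y : R => Y / 4) (1 / 4).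
  have := is_deriveZ (4^-1 : R) (is_derive_id X (1 : R)).
  rewrite (_ : _ \*: _ = fun Y : R => Y / 4); last first.
    by apply/funext => Y; rewrite mulrC.
  by move/is_derive_eq; apply; rewrite /GRing.scale/= mulrC.
have d2 := @is_derive1_comp _ _ (fun Y : R => Y / 4) _ _ _
  (is_derive_expR (X / 4)) d1.
have d3 := is_derive1_sqrt X0.
have s0 : Num.sqrt X != 0 by rewrite gt_eqF ?sqrtr_gt0.
have := is_deriveM d2 d3.
move/is_derive_eq; apply; rewrite /GRing.scale/= /integrating_factor.
have XE : X = Num.sqrt X ^+ 2 by rewrite sqr_sqrtr ?ltW.
rewrite [in 2 * X]XE.
by field.
Qed.

(** [expR (- (sqrt X / 2) ^ 2)] is [expR (- X / 4)], and differentiating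
    [sqrt X / 2] contributes the factor [1 / sqrt X]: together they form the
    inverse of the integrating factor. *)
Lemma is_derive_erf_profile {R : realType} (K k2 X : R) : 0 < X ->
  is_derive X 1 (erf_profile K k2)
    (Num.sqrt pi * K * (integrating_factor X)^-1).
Proof.
move=> X0.
have s0 : 0 < Num.sqrt X by rewrite sqrtr_gt0.
have z0 : 0 < Num.sqrt X / 2 by rewrite divr_gt0.
have d1 : is_derive X 1 (fun Y : R => Num.sqrt Y / 2) (4 * Num.sqrt X)^-1.
  have := is_deriveZ (2^-1 : R) (is_derive1_sqrt X0).
  rewrite (_ : _ \*: _ = fun Y : R => Num.sqrt Y / 2); last first.
    by apply/funext => Y; rewrite mulrC.
  move/is_derive_eq; apply; rewrite /GRing.scale/=.
  by field; rewrite gt_eqF.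
have d2 := @is_derive1_comp _ _ (fun Y : R => Num.sqrt Y / 2) _ _ _
  (is_derive_erf z0) d1.
have := is_deriveD (is_derive_cst k2 X (1 : R)) (is_deriveZ (2 * pi * K) d2).
move/is_derive_eq; apply; rewrite /GRing.scale/= /integrating_factor add0r.
have -> : - (Num.sqrt X / 2) ^+ 2 = - (X / 4).
  by rewrite exprMn sqr_sqrtr ?ltW//; field.
rewrite expRN.
have pE : pi = Num.sqrt pi ^+ 2 :> R by rewrite sqr_sqrtr ?pi_ge0.
rewrite [in 2 * pi]pE.
have p0 : Num.sqrt pi != 0 :> R by rewrite gt_eqF ?sqrtr_gt0 ?pi_gt0.
by field; rewrite p0 !gt_eqF ?expR_gt0.
Qed.

(** For [psi = ln L / k + k3] one has [k (psi'' + k psi' ^ 2) = L'' / L], and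
    [L'] is a multiple of the inverse of the integrating factor, whose
    logarithmic derivative is [- (1 / 4 + 1 / (2 X))]. *)
Lemma log_erf_profile_ode {R : realType} {k K k2 k3 X : R} :
  k != 0 -> (forall Y, 0 < Y -> 0 < erf_profile K k2 Y) -> 0 < X ->
  let psi Y := 1 / k * ln (erf_profile K k2 Y) + k3 in
  [/\ derivable psi X 1, derivable (derive1 psi) X 1 &
      similarity_ode k psi X].
Proof.
move=> k0 L0 X0 psi.
pose C : R := Num.sqrt pi * K.
pose p1 Y := k^-1 * (C * ((integrating_factor Y)^-1 * (erf_profile K k2 Y)^-1)).
have dpsi (Y : R) : 0 < Y -> is_derive Y 1 psi (p1 Y).
  move=> Y0.
  have d1 := is_derive1_comp (is_derive1_ln (L0 Y Y0))
    (is_derive_erf_profile K k2 Y Y0).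
  have := is_deriveD (is_deriveZ (1 / k) d1) (is_derive_cst k3 Y (1 : R)).
  move/is_derive_eq; apply.
  by rewrite /GRing.scale/= /p1 /C; ring.
have E1 : \forall Y \near X, p1 Y = derive1 psi Y.
  near=> Y; rewrite (is_derive_derive1 (dpsi Y _))//; near: Y.
  exact: lt_nbhsr.
have T0 := integrating_factor_neq0 X X0.
have LX0 : erf_profile K k2 X != 0 by rewrite gt_eqF ?L0.
have d2 := is_deriveZ k^-1 (is_deriveZ C
  (is_deriveM (is_deriveV T0 (is_derive_integrating_factor X X0))
              (is_deriveV LX0 (is_derive_erf_profile K k2 X X0)))).
have dd := near_eq_is_derive E1 d2.
split; [by case: (dpsi X X0)|by case: dd|].
rewrite /similarity_ode -[derive1n 2 psi X]/(derive1 (derive1 psi) X).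
rewrite (is_derive_derive1 dd) (is_derive_derive1 (dpsi X X0)).
rewrite /GRing.scale/= /p1 /C.
have X1 : X != 0 by rewrite gt_eqF.
by field; rewrite k0 T0 LX0 X1.
Unshelve. all: by end_near. Qed.

(** With [L = exp (k psi)] the equation says that [M = L' T] has derivative 0,
    [T] being the integrating factor.  So [L'] is a multiple of [1 / T], the
    derivative of an erf profile, and [L] differs from that profile by a
    constant. *)
Lemma similarity_ode_profile {R : realType} {k : R} {psi : R -> R} :
  (forall X, 0 < X -> derivable psi X 1 /\ derivable (derive1 psi) X 1) ->
  (forall X, 0 < X -> similarity_ode k psi X) ->
  exists K k2, forall X, 0 < X -> expR (k * psi X) = erf_profile K k2 X.
Proof.
move=> dpsi ode.
pose L X := expR (k * psi X).
pose T : R -> R := integrating_factor.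
have dL (X : R) : 0 < X -> is_derive X 1 L (k * derive1 psi X * L X).
  move=> X0; have [d1 _] := dpsi X X0.
  have := @is_derive1_comp _ _ (k \*: psi) _ _ _ (is_derive_expR (k * psi X))
    (is_deriveZ k (derivable_is_derive1 d1)).
  by move/is_derive_eq; apply; rewrite mulrC.
pose M X := k * derive1 psi X * L X * T X.
have M_cst (X : R) : 0 < X -> M X = M 1.
  move=> X0; apply: derive0_gt0_cst => // Y Y0.
  have [_ d1] := dpsi Y Y0.
  have := is_deriveM (is_deriveM (is_deriveZ k (derivable_is_derive1 d1)) (dL Y Y0))
    (is_derive_integrating_factor Y Y0).
  move/is_derive_eq; apply.
  transitivity (k * derive1 psi Y * L Y * ((1 / 4 + 1 / (2 * Y)) * T Y)
      + T Y * (k * derive1 psi Y * (k * derive1 psi Y * L Y)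
               + L Y * (k * derive1 (derive1 psi) Y))) => //.
  have := ode Y Y0.
  rewrite /similarity_ode -[derive1n 2 psi Y]/(derive1 (derive1 psi) Y) => e.
  rewrite -[RHS](mulr0 (k * L Y * T Y)) -e.
  by ring.
have p0 : Num.sqrt pi != 0 :> R by rewrite gt_eqF ?sqrtr_gt0 ?pi_gt0.
(* an erf profile has derivative [sqrt pi * K / T], to be matched with [M 1 / T] *)
pose K := M 1 / Num.sqrt pi.
pose H X := L X - erf_profile K 0 X.
have H_cst (X : R) : 0 < X -> H X = H 1.
  move=> X0; apply: derive0_gt0_cst => // Y Y0.
  have := is_deriveB (dL Y Y0) (is_derive_erf_profile K 0 Y Y0).
  move/is_derive_eq; apply; rewrite /K -(M_cst Y Y0) /M -/(T Y).
  by field; rewrite p0 integrating_factor_neq0.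
exists K, (H 1) => X X0.
by rewrite -(H_cst X X0) /H /erf_profile add0r subrK.
Qed.

(** * The range of the similarity variable *)

Lemma similarity_var_gt0 {R : realType} {beta x t : R} {G : R -> R} :
  0 < beta < 1 -> 0 < G t -> 0 < x -> 0 < similarity_var beta G x t.
Proof.
move=> hb Gt x0.
by rewrite divr_gt0 ?powR_gt0// mulr_gt0// exprn_gt0 ?Gamma_gt0.
Qed.

Lemma similarity_var_onto {R : realType} {beta t X : R} {G : R -> R} :
  0 < beta < 1 -> 0 < G t -> 0 < X ->
  exists2 x, 0 < x & similarity_var beta G x t = X.
Proof.
move=> hb Gt X0; have b0 : 0 < beta by case/andP: hb.
have m0 : 0 < Gamma (1 + beta) ^+ 2 * G t.
  by rewrite mulr_gt0// exprn_gt0 ?Gamma_gt0.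
exists ((X * (Gamma (1 + beta) ^+ 2 * G t)) `^ (2 * beta)^-1).
  by apply: powR_gt0; apply: mulr_gt0.
have e0 : 2 * beta != 0 by rewrite gt_eqF// mulr_gt0.
rewrite /similarity_var -powRrM mulVf// powRr1; last by rewrite ltW// mulr_gt0.
by rewrite mulfK// gt_eqF.
Qed.

Lemma erf_profile_similarity_var {R : realType} {beta x t : R} {G : R -> R}
    (K k2 : R) :
  0 < beta < 1 -> 0 < G t -> 0 < x ->
  erf_profile K k2 (similarity_var beta G x t) = log_argument beta G K k2 x t.
Proof.
move=> hb Gt x0; rewrite /erf_profile /log_argument.
have c0 := Gamma_gt0 hb; have s0 : 0 < Num.sqrt (G t) by rewrite sqrtr_gt0.
have -> : similarity_var beta G x t
    = (x `^ beta / (Gamma (1 + beta) * Num.sqrt (G t))) ^+ 2.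
  by rewrite expr_div_n exprMn sqr_sqrtr ?ltW// -powR_double.
rewrite sqrtr_sqr ger0_norm ?divr_ge0 ?powR_ge0 ?mulr_ge0 ?ltW//.
congr (_ + _ * erf _); field; by rewrite !gt_eqF.
Qed.

(** * The theorem *)

(* G is F_t^(alpha); its value at 0, which enters F_t^(2 alpha), is left to
   the choice of G. *)
Theorem theorem4p2 (R : realType) (alpha beta k : R) (f g F G : R -> R)
    (Dt Dx : (R -> R) -> R -> R -> Prop)
    (halpha : 0 < alpha < 1) (hbeta : 0 < beta < 1) (hk : k != 0)
    (hf : forall t : R, 0 < t -> f t != 0)
    (hg : forall t : R, 0 < t -> g t = k * f t)
    (hF : forall t : R, 0 < t -> is_jumarie alpha F t (G t))
    (hG : forall t : R, 0 < t -> is_jumarie alpha G t (f t))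
    (hG0 : forall t : R, 0 < t -> G t != 0)
    (hpow : jumarie_power_rule R)
    (hDt : jumarie_calculus alpha G Dt)
    (hDx : jumarie_calculus beta (fun x => x `^ beta) Dx) :
  [/\ (* reduction *)
      forall psi : R -> R,
        (forall x t : R, 0 < x -> 0 < t ->
           derivable psi (similarity_var beta G x t) 1 /\
           derivable (derive1 psi) (similarity_var beta G x t) 1) ->
        forall x t : R, 0 < x -> 0 < t ->
          (burgers_at Dt Dx f g
             (fun y s => psi (similarity_var beta G y s)) x t <->
           similarity_ode (g t / f t) psi (similarity_var beta G x t)),
      (* the formula solves the equation *)
      (forall t : R, 0 < t -> 0 < G t) ->
        forall K k2 k3 : R,
          (forall x t : R, 0 < x -> 0 < t -> 0 < log_argument beta G K k2 x t) ->
          forall x t : R, 0 < x -> 0 < t ->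
            burgers_at Dt Dx f g (burgers_solution beta k G K k2 k3) x t &
      (* every solution of the reduced equation yields this formula *)
      (forall t : R, 0 < t -> 0 < G t) ->
        forall psi : R -> R,
          (forall x t : R, 0 < x -> 0 < t ->
             derivable psi (similarity_var beta G x t) 1 /\
             derivable (derive1 psi) (similarity_var beta G x t) 1) ->
          (forall x t : R, 0 < x -> 0 < t ->
             similarity_ode (g t / f t) psi (similarity_var beta G x t)) ->
          exists K k2 k3 : R,
            (forall x t : R, 0 < x -> 0 < t ->
               0 < log_argument beta G K k2 x t) /\
            (forall x t : R, 0 < x -> 0 < t ->
               psi (similarity_var beta G x t)
                 = burgers_solution beta k G K k2 k3 x t)].
Proof.
have kE t : 0 < t -> g t / f t = k.
  by move=> t0; rewrite hg// mulfK// hf.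
have reduction psi : (forall x t : R, 0 < x -> 0 < t ->
      derivable psi (similarity_var beta G x t) 1 /\
      derivable (derive1 psi) (similarity_var beta G x t) 1) ->
    forall x t : R, 0 < x -> 0 < t ->
      (burgers_at Dt Dx f g (fun y s => psi (similarity_var beta G y s)) x t <->
       similarity_ode (g t / f t) psi (similarity_var beta G x t)).
  move=> dpsi x t x0 t0.
  apply: (similarity_reduction hbeta hpow hDt hDx) => //.
  - exact: hG.
  - exact: hf.
  - exact: hG0.
  - by move=> y y0; case: (dpsi y t y0 t0).
  - by case: (dpsi x t x0 t0).
split; first exact: reduction.
- move=> Gpos K k2 k3 Lpos.
  have profile_gt0 (Y : R) : 0 < Y -> 0 < erf_profile K k2 Y.
    move=> Y0; have [x x0 <-] := similarity_var_onto hbeta (Gpos 1 ltr01) Y0.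
    by rewrite erf_profile_similarity_var// ?Lpos ?Gpos.
  pose psi Y := 1 / k * ln (erf_profile K k2 Y) + k3.
  have psi_ode (x t : R) : 0 < x -> 0 < t ->
      [/\ derivable psi (similarity_var beta G x t) 1,
          derivable (derive1 psi) (similarity_var beta G x t) 1 &
          similarity_ode k psi (similarity_var beta G x t)].
    move=> x0 t0; apply: log_erf_profile_ode => //.
    by apply: similarity_var_gt0 => //; exact: Gpos.
  move=> x t x0 t0.
  apply: (burgers_at_ext hDt hDx (u := fun y s => psi (similarity_var beta G y s)))
    => // [y s y0 s0|].
    by rewrite /psi erf_profile_similarity_var// Gpos.
  apply/reduction => //.
    by move=> y s y0 s0; case: (psi_ode y s y0 s0).
  by rewrite kE//; case: (psi_ode x t x0 t0).
- move=> Gpos psi dpsi ode.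
  have [||K [k2 profileE]] := @similarity_ode_profile R k psi.
  + move=> Y Y0; have [x x0 <-] := similarity_var_onto hbeta (Gpos 1 ltr01) Y0.
    exact: dpsi.
  + move=> Y Y0; have [x x0 <-] := similarity_var_onto hbeta (Gpos 1 ltr01) Y0.
    by rewrite -(kE 1 ltr01); exact: ode.
  have LE (x t : R) : 0 < x -> 0 < t ->
      expR (k * psi (similarity_var beta G x t)) = log_argument beta G K k2 x t.
    move=> x0 t0; have Gt := Gpos t t0.
    rewrite -erf_profile_similarity_var//.
    by apply: profileE; exact: similarity_var_gt0.
  exists K, k2, 0; split=> x t x0 t0; first by rewrite -LE// expR_gt0.
  by rewrite /burgers_solution -LE// expRK addr0 div1r mulKf.
Qed.
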